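(* There exists a pentagonal geometry $\mathrm{PENT}(5,r)$ with a connected deficiency graph of girth at least $5$ for each $$r \in \{20, 21, 25, 26, 30, 31, 35, 36, 40, 41, 45\}.$$
   Context: A partial linear space is a (finite) set of points together with a set of lines, each line identified with the set of points incident with it, such that two distinct points lie on at most one common line. Two points are collinear if some line contains both (so a point that lies on a line is collinear with itself). A pentagonal geometry $\mathrm{PENT}(k,r)$ is a partial linear space in which every line has exactly $k$ points, every point is on exactly $r$ lines, and for every point $x$ the set of points not collinear with $x$ is (the point set of) a line of the geometry. Its deficiency graph has the points of the geometry as vertices, with $x \sim y$ precisely when $x$ and $y$ are not collinear. *)

(* Defs.v *)
From mathcomp Require Import all_boot.

Set Implicit Arguments.
Unset Strict Implicit.
Unset Printing Implicit Defensive.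

Record partial_linear_space := PartialLinearSpace {
  point : finType;
  lines : {set {set point}};
  line_uniq : forall (x y : point) (l m : {set point}),
    x != y -> l \in lines -> m \in lines ->
    x \in l -> y \in l -> x \in m -> y \in m -> l = m
}.

Definition collinear (G : partial_linear_space) : rel (point G) :=
  fun x y => [exists l in lines G, (x \in l) && (y \in l)].

Definition pentagonal (k r : nat) (G : partial_linear_space) : Prop :=
  [/\ forall l : {set point G}, l \in lines G -> #|l| = k,
      forall x : point G, #|[set l in lines G | x \in l]| = r
    & forall x : point G, [set y | ~~ collinear x y] \in lines G].

(* When every point is on a line, as in a pentagonal geometry with r > 0,
   this relation is irreflexive: the deficiency graph has no loops. *)
Definition deficiency (G : partial_linear_space) : rel (point G) :=
  fun x y => ~~ collinear x y.

(* The null graph is not connected; without this convention the empty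
   geometry would be a degenerate PENT(k,r) with connected deficiency graph
   for all k and r. *)
Definition connected_graph (T : finType) (e : rel T) : Prop :=
  0 < #|T| /\ forall x y : T, connect e x y.

(* [ucycle e c] says that the vertices of c are distinct, consecutive ones are
   adjacent, and the last is adjacent to the first; the condition on the size
   excludes single edges traversed back and forth.  An acyclic graph
   has infinite girth. *)
Definition girth_at_least (g : nat) (T : finType) (e : rel T) : Prop :=
  forall c : seq T, 3 <= size c -> ucycle e c -> g <= size c.

(* Main.v *)
Require Import Defs.
From mathcomp Require Import all_boot ssralg finalg zmodp.

(** A pentagonal geometry PENT(k, r) has [k + 1 + r (k - 1)] points: a point
    [x], the [k] points of its opposite line, and the [k - 1] further points
    of each of the [r] lines through [x].  For [k = 5] this is [4 r + 6], an
    even number, and each geometry is built on the integers modulo [4 r + 6]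
    so that [x |-> x + 2] is an automorphism: its lines are the translates, by
    even numbers, of a short list of starter blocks, found by a computer
    search.

    Such a family of lines is determined locally.  A translation moves any
    point to [0] or to [1], so all axioms can be read off from the lines
    through these two points.  If the lines through a base point [p] meet
    pairwise only in [p] ([pencil_uniq]) and miss [p]'s opposite block [N(p)],
    then counting points shows that [p], [N(p)] and those lines partition the
    point set: two lines never share two points, and [N(p)] is exactly the set
    of points not collinear with [p].

    The deficiency graph then joins [x] to the translate [N(x)] of the
    opposite block of its base point.  It has girth at least 5 precisely when
    the walks of length at most 2 that leave a vertex without backtracking
    reach distinct vertices ([ball2_uniq]), which again is a condition at [0]
    and [1] only.  It is connected as soon as [1] and [2] are at distance at
    most 2 from [0], because the translates of a walk from [0] to [2] link all
    even numbers, and those of a walk from [0] to [1] link the even numbers to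
    the odd ones.

    All of this is proved in [Section Development] for any finite abelian
    group and any cyclic subgroup of translations; it leaves finitely many
    equations about each list of starter blocks, which are settled by
    evaluation. *)

Set Implicit Arguments.
Unset Strict Implicit.
Unset Printing Implicit Defensive.

Import GRing.Theory.

(** * Development of starter blocks under a group of translations *)

Lemma flatten_uniq_inj (S T : eqType) (f : S -> seq T) (s : seq S) x y z :
  uniq (flatten [seq f x | x <- s]) ->
  x \in s -> y \in s -> z \in f x -> z \in f y -> x = y.
Proof.
elim: s => //= a s IHs; rewrite cat_uniq => /and3P[_ /hasPn disj /IHs{}IHs].
have clash b : b \in s -> z \in f a -> z \in f b -> False.
  by move=> sb za zb; have /disj/negP[] : z \in flatten [seq f x | x <- s];
    [apply/flatten_mapP; exists b | ].
rewrite !inE => /predU1P[->|sx] /predU1P[->|sy] // zx zy.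
- by case: (clash y).
- by case: (clash x).
- exact: IHs.
Qed.

Section Development.

Local Open Scope ring_scope.

Variables (V : finZmodType) (H : {pred V}) (le : rel V).
Hypothesis H_zmod : zmod_closed H.

(* [base x] is the base point in the orbit of [x] under translation by [H],
   and [opp p] is the starter block opposite to the base point [p]. *)
Variables (blocks : seq (seq V)) (base : V -> V) (opp : V -> seq V).
Hypothesis baseP : forall x, x - base x \in H.

Definition translate (t : V) (B : seq V) := [seq x + t | x <- B].

(** The lines through [p].  The translate of [B] taking [q] to [p] contains
    [p]; when [B] is invariant under some translations, several points [q] of
    [B] give the same line with its points listed in different orders, and
    sorting lets [undup] identify these copies. *)
Definition pencil (p : V) : seq (seq V) :=
  undup [seq sort le (translate (p - q) B)
        | B <- blocks, q <- [seq q <- B | p - q \in H]].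

(** The points not collinear with [x], see [collinearE]. *)
Definition nbr (x : V) := translate (x - base x) (opp (base x)).

(** The tree of walks of length at most 2 from [x] without backtracking. *)
Definition ball2 (x : V) :=
  x :: nbr x ++ flatten [seq [seq z <- nbr y | z != x] | y <- nbr x].

Variables k r : nat.
Hypothesis k_gt1 : (1 < k)%N.
Hypothesis r_gt0 : (0 < r)%N.
Hypothesis cardV : #|V| = (k.+1 + r * k.-1)%N.
Hypothesis blocksP : {in blocks, forall B, uniq B && (size B == k)}.
Hypothesis oppP : forall x, opp (base x) \in blocks.
Hypothesis size_pencil : forall x, size (pencil (base x)) = r.
Hypothesis pencil_uniq : forall x, let p := base x in
  uniq (p :: opp p ++ flatten [seq rem p L | L <- pencil p]).
Hypothesis baseD : forall x h, h \in H -> base (x + h) = base x.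

Lemma mem_translate t B x : (x \in translate t B) = (x - t \in B).
Proof.
apply/mapP/idP => [[y By ->]|Bx]; first by rewrite addrK.
by exists (x - t); rewrite ?subrK.
Qed.

Lemma H0 : 0 \in H. Proof. by case: H_zmod. Qed.
Lemma HB x y : x \in H -> y \in H -> x - y \in H.
Proof. by case: H_zmod => _; apply. Qed.
Lemma HN x : x \in H -> - x \in H.
Proof. by move=> Hx; rewrite -sub0r HB ?H0. Qed.
Lemma HD x y : x \in H -> y \in H -> x + y \in H.
Proof. by move=> Hx Hy; rewrite -[y]opprK HB ?HN. Qed.

Definition dev_lines : {set {set V}} :=
  [set l | [exists h in H, has (fun B => l == [set x in translate h B]) blocks]].

Lemma dev_linesP (l : {set V}) :
  reflect (exists B h, [/\ B \in blocks, h \in H & l = [set x in translate h B]])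
          (l \in dev_lines).
Proof.
rewrite inE; apply: (iffP existsP) => [[h /andP[Hh /hasP[B bB /eqP->]]]|].
  by exists B, h.
case=> B [h [bB Hh ->]]; exists h; rewrite Hh /=; apply/hasP.
by exists B.
Qed.

Lemma pencilP p L :
  reflect (exists B q, [/\ B \in blocks, q \in B, p - q \in H
                        & L = sort le (translate (p - q) B)])
          (L \in pencil p).
Proof.
rewrite mem_undup; apply: (iffP allpairsPdep) => [[B [q [bB]]]|].
  by rewrite mem_filter => /andP[Hq Bq] ->; exists B, q.
by case=> B [q [bB Bq Hq ->]]; exists B, q; rewrite mem_filter Hq.
Qed.

Lemma pencil_block p L : L \in pencil p ->
  [/\ uniq L, size L = k & p \in L].
Proof.
case/pencilP=> B [q [/blocksP/andP[uB /eqP sB] Bq _ ->]].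
rewrite sort_uniq size_sort size_map mem_sort mem_translate.
by rewrite map_inj_uniq ?uB ?subKr //; exact: addIr.
Qed.

Definition dev_line (x : V) (L : seq V) : {set V} :=
  [set y in translate (x - base x) L].

(** Translation by [x - base x] maps the lines through [base x] onto those
    through [x]; this reduces statements about [x] to its base point. *)
Lemma line_through (l : {set V}) x :
  reflect (exists2 L, L \in pencil (base x) & l = dev_line x L)
          ((l \in dev_lines) && (x \in l)).
Proof.
set p := base x; apply: (iffP andP) => [[/dev_linesP[B [h [bB Hh ->]]]]|].
  rewrite inE mem_translate => Bx.
  exists (sort le (translate (p - (x - h)) B)).
    apply/pencilP; exists B, (x - h); split=> //.
    by rewrite opprB addrCA -opprB HB ?baseP.
  apply/setP=> y; rewrite !inE !mem_translate mem_sort mem_translate.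
  by rewrite -[in RHS]addrA -opprD addrA subrK subKr.
case=> L pL ->; split; last first.
  by have [_ _] := pencil_block pL; rewrite inE mem_translate subKr.
have /pencilP[B [q [bB Bq Hq ->]]] := pL.
apply/dev_linesP; exists B, (x - q); split=> //.
  by rewrite -(subrK p x) -addrA HD ?baseP.
apply/setP=> y; rewrite !inE !mem_translate mem_sort mem_translate.
congr (_ \in B).
by rewrite -addrA -opprD addrA subrK.
Qed.

Lemma pencil_eq p L M y : L \in pencil (base p) -> M \in pencil (base p) ->
  y != base p -> y \in L -> y \in M -> L = M.
Proof.
set q := base p => pL pM neq yL yM.
have := pencil_uniq p; rewrite -/q /= cat_uniq => /and4P[_ _ _ uF].
apply: (flatten_uniq_inj uF pL pM (z := y)).
  by have [uL _ _] := pencil_block pL; rewrite mem_rem_uniq // inE neq.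
by have [uM _ _] := pencil_block pM; rewrite mem_rem_uniq // inE neq.
Qed.

Lemma mem_dev_line x L y : (y \in dev_line x L) = (y - (x - base x) \in L).
Proof. by rewrite inE mem_translate. Qed.

Lemma shift_eq_base x y : (y - (x - base x) == base x) = (y == x).
Proof.
by rewrite opprB addrA [_ + base x]addrC -addrA -subr_eq0 [_ + _ - _]addrC addKr
           subr_eq0.
Qed.

Lemma dev_line_uniq (x y : V) (l m : {set V}) :
  x != y -> l \in dev_lines -> m \in dev_lines ->
  x \in l -> y \in l -> x \in m -> y \in m -> l = m.
Proof.
move=> neq Dl Dm xl yl xm ym.
have /line_through[L pL def_l] : (l \in dev_lines) && (x \in l) by rewrite Dl.
have /line_through[M pM def_m] : (m \in dev_lines) && (x \in m) by rewrite Dm.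
move: yl ym; rewrite def_l def_m !mem_dev_line => yL yM.
by rewrite (pencil_eq pL pM _ yL yM) // shift_eq_base eq_sym.
Qed.

Definition development := PartialLinearSpace dev_line_uniq.

Lemma card_dev_line (l : {set V}) : l \in dev_lines -> #|l| = k.
Proof.
case/dev_linesP=> B [h [/blocksP/andP[uB /eqP sB] _ ->]].
by rewrite cardsE (card_uniqP _) ?size_map // map_inj_uniq //; apply: addIr.
Qed.

Lemma card_lines_through (x : V) : #|[set l in dev_lines | x \in l]| = r.
Proof.
set p := base x.
have -> : [set l in dev_lines | x \in l]
          = [set l in [seq dev_line x L | L <- pencil p]].
  apply/setP=> l; rewrite [LHS]in_set [RHS]in_set.
  by apply/line_through/mapP => -[L pL ->]; exists L.
rewrite cardsE (card_uniqP _) ?size_map ?size_pencil //.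
rewrite map_inj_in_uniq ?undup_uniq // => L M pL pM eqLM.
have [uL sL pinL] := pencil_block pL.
have: (0 < size (rem p L))%N by rewrite size_rem // sL; case: (k) k_gt1 => [|[]].
case def_s: (rem p L) => [|z s] // _.
have: z \in rem p L by rewrite def_s mem_head.
rewrite mem_rem_uniq // inE => /andP[zp zL].
apply: (pencil_eq pL pM zp zL).
have /setP/(_ (z + (x - p))) := eqLM.
by rewrite !mem_dev_line addrK zL => <-.
Qed.

(** The three parts are disjoint by [pencil_uniq], and their sizes [1], [k]
    and [r (k - 1)] add up to the number of points. *)
Lemma pencil_cover x y :
  y \in base x :: opp (base x) ++ flatten [seq rem (base x) L | L <- pencil (base x)].
Proof.
set p := base x; set s := _ :: _.
have size_s : size s = #|V|.
  rewrite /s /= size_cat size_flatten /shape -map_comp cardV.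
  have /andP[_ /eqP->] := blocksP (oppP x).
  suff -> : [seq size (rem p L) | L <- pencil p] = nseq r k.-1.
    by rewrite sumn_nseq mulnC.
  rewrite -(size_pencil x) -/p; elim: (pencil p) (@pencil_block p) => //= L t IHt tP.
  have [_ sL pinL] := tP L (mem_head _ _).
  by rewrite size_rem // sL IHt // => M tM; apply: tP; rewrite inE tM orbT.
have /subset_cardP/(_ _) : #|s| = #|predT : pred V|.
  by rewrite (card_uniqP (pencil_uniq x)) size_s cardT.
by move/(_ (subset_predT _)) ->.
Qed.

Lemma collinearE x y : @collinear development x y = (y \notin nbr x).
Proof.
set p := base x; pose z := y - (x - p).
have -> : (y \in nbr x) = (z \in opp p) by rewrite mem_translate.
have := pencil_uniq x; rewrite -/p /= mem_cat negb_or cat_uniq.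
case/andP=> /andP[p_opp _] /and3P[_ /hasPn disj _].
apply/existsP/idP => [[l /and3P[Dl xl yl]]|z_opp].
  have /line_through[L pL def_l] : (l \in dev_lines) && (x \in l) by rewrite Dl.
  move: yl; rewrite def_l mem_dev_line -/p -/z => zL.
  have [zp|zp] := eqVneq z p; first by rewrite zp.
  apply: disj; apply/flatten_mapP; exists L => //.
  by have [uL _ _] := pencil_block pL; rewrite mem_rem_uniq // inE zp.
suff [L pL zL]: exists2 L, L \in pencil p & z \in L.
  exists (dev_line x L); rewrite andbA (mem_dev_line x L y) zL andbT.
  by apply/line_through; exists L.
have := pencil_cover x z; rewrite inE mem_cat (negPf z_opp) /= -/p.
case/predU1P=> [->|/flatten_mapP[L pL /mem_rem]]; last by exists L.
have: (0 < size (pencil p))%N by rewrite size_pencil.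
case def_s: (pencil p) => [|L s] // _; exists L; first exact: mem_head.
by have [|] := @pencil_block p L; rewrite // def_s mem_head.
Qed.

Lemma deficiencyE x y : @deficiency development x y = (y \in nbr x).
Proof. by rewrite /deficiency collinearE negbK. Qed.

Lemma nbr_sym x y : (y \in nbr x) = (x \in nbr y).
Proof.
rewrite -!deficiencyE /deficiency; congr (~~ _).
by apply/existsP/existsP => -[l /and3P[? ? ?]]; exists l; apply/and3P.
Qed.

Lemma dev_pentagonal : pentagonal k r development.
Proof.
split; [exact: card_dev_line | exact: card_lines_through |].
move=> x; apply/dev_linesP; exists (opp (base x)), (x - base x); split=> //.
by apply/setP=> y; rewrite !inE collinearE negbK.
Qed.

Lemma nbrD x y h : h \in H -> (y + h \in nbr (x + h)) = (y \in nbr x).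
Proof.
move=> Hh; rewrite !mem_translate baseD //.
by rewrite [x + h - _]addrAC opprD addrA [y + h - _]addrAC addrK.
Qed.

Lemma nbr_base x y : (y - (x - base x) \in nbr (base x)) = (y \in nbr x).
Proof. by rewrite -[RHS](nbrD _ _ (HN (baseP x))) subKr. Qed.

Hypothesis ball2_uniq : forall x, uniq (ball2 (base x)).

Lemma nbr_neq x y : y \in nbr x -> y != x.
Proof.
rewrite -nbr_base -(shift_eq_base x); set p := base x => nz.
have := ball2_uniq x; rewrite -/p /= mem_cat negb_or => /andP[/andP[p_nbr _] _].
by apply: contraNneq p_nbr => eq_p; rewrite -[X in X \in _]eq_p.
Qed.

(** A common neighbour of [x] and [y], or a second common neighbour of [x] and
    [z], would give two occurrences of the same vertex in [ball2 x]. *)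
Lemma no_short_cycle x y z : y \in nbr x -> z \in nbr y -> z != x ->
  (z \notin nbr x) /\ (forall w, w \in nbr x -> z \in nbr w -> w = y).
Proof.
have shift u v : (v \in nbr u) = (v - (x - base x) \in nbr (u - (x - base x))).
  by rewrite (nbrD _ _ (HN (baseP x))).
set p := base x in shift *; set d := x - p in shift *.
have d_x : x - d = p by rewrite subKr.
have := ball2_uniq x; rewrite -/p /= cat_uniq => /andP[_ /and3P[_ /hasPn disj uF]].
move=> xy yz zx; have zp : z - d != p by rewrite shift_eq_base.
have mem_z w : w \in nbr x -> z \in nbr w ->
  (w - d \in nbr p) && (z - d \in [seq z <- nbr (w - d) | z != p]).
  by rewrite -{1}d_x mem_filter zp /= !(shift x) !(shift w) d_x => -> ->.
have /andP[py yz'] := mem_z y xy yz.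
split=> [|w xw wz].
  rewrite shift d_x; apply: disj; apply/flatten_mapP.
  by exists (y - d).
have /andP[pw wz'] := mem_z w xw wz.
exact: addIr (flatten_uniq_inj uF pw py wz' yz').
Qed.

Lemma dev_girth : girth_at_least 5 (@deficiency development).
Proof.
have defE := deficiencyE.
case=> [|x [|y [|z [|w [|? c]]]]] // _ /andP[] /=; rewrite !defE.
  case/and4P=> xy yz zx _ _.
  have [] := no_short_cycle xy yz (nbr_neq _); first by rewrite nbr_sym.
  by rewrite nbr_sym zx.
case/and5P=> xy yz zw wx _; rewrite !inE !negb_or.
case/and4P=> /and3P[_ xz _] /andP[_ yw] _ _.
have [|_ /(_ w)] := no_short_cycle xy yz; first by rewrite eq_sym.
rewrite nbr_sym wx nbr_sym zw => /(_ isT isT) w_y.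
by rewrite w_y eqxx in yw.
Qed.

Variables (g : V) (reps : seq V).
Hypothesis H_cyclic : forall h, h \in H -> exists n, h = g *+ n.
Hypothesis gH : g \in H.
Hypothesis base_reps : forall x, base x \in reps.
Hypothesis ball2_reps : {subset g :: reps <= ball2 0}.

Lemma dev_connected : connected_graph (@deficiency development).
Proof.
split; first by apply/card_gt0P; exists 0.
set e := @deficiency development.
have esym : connect_sym e.
  by apply: sym_connect_sym => x y; rewrite /e !deficiencyE nbr_sym.
have shift h x y : h \in H -> connect e x y -> connect e (x + h) (y + h).
  move=> Hh /connectP[s es ->]; apply/connectP.
  exists [seq x + h | x <- s]; last by rewrite (last_map (+%R^~ h)).
  elim: s x es => //= y' s IHs x /andP[xy' /IHs->]; rewrite andbT.
  by move: xy'; rewrite /e !deficiencyE nbrD.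
have ball x : x \in ball2 0 -> connect e 0 x.
  rewrite inE mem_cat => /or3P[/eqP->|x0|/flatten_mapP[y y0]] //.
    by apply: connect1; rewrite /e deficiencyE.
  rewrite mem_filter => /andP[_ xy]; apply: (@connect_trans _ _ y);
  by apply: connect1; rewrite /e deficiencyE.
have conH n : connect e 0 (g *+ n) /\ g *+ n \in H.
  elim: n => [|n [IHn Hn]]; first by rewrite mulr0n H0.
  rewrite mulrS HD //; split=> //; apply: connect_trans IHn _.
  rewrite -[X in connect e X]add0r; apply: shift => //.
  by apply: ball; apply: ball2_reps; apply: mem_head.
have con0 x : connect e 0 x.
  have [n def_n] := H_cyclic (baseP x); have [con Hn] := conH n.
  apply: connect_trans con _; rewrite -(subrK (base x) x) def_n addrC.
  rewrite -[X in connect e X]add0r; apply: shift => //.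
  by apply: ball; apply: ball2_reps; rewrite inE base_reps orbT.
by move=> x y; apply: connect_trans (con0 y); rewrite esym.
Qed.

End Development.

(** * Starter blocks under translation by two *)

Section StepTwo.

Local Open Scope ring_scope.

Variables k r : nat.

(* With [N = k + r (k - 1)] this is the group of integers modulo [N + 1]. *)
Let V := 'I_(k + r * k.-1).+1.

Definition parity_rep (x : V) : V := inZp (odd x).

Variable starters : seq (seq nat).

Definition starter_blocks : seq (seq V) :=
  [seq [seq inZp a | a <- B] | B <- starters].

(** The first two starter blocks are the opposites of [0] and of [1]. *)
Definition opposite (x : V) : seq V := nth [::] starter_blocks (odd x).

Definition evens : {pred V} := [pred x : V | ~~ odd x].

Definition ord_leq : rel V := fun x y => (x <= y)%N.

Definition local_check (p : V) : bool :=
  let P := pencil evens ord_leq starter_blocks p in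
  [&& size P == r, uniq (p :: opposite p ++ flatten [seq rem p L | L <- P])
    & uniq (ball2 parity_rep opposite p)].

(** The last clause is for connectedness; the requirement that [N] is odd
    makes parity meaningful modulo [N + 1]. *)
Definition starter_check : bool :=
  [&& 1 < k, 0 < r, odd (k + r * k.-1), 1 < size starters,
      all (fun B => uniq B && (size B == k)) starter_blocks,
      local_check (inZp 0), local_check (inZp 1)
    & all [in ball2 parity_rep opposite 0%R] [:: inZp 2; inZp 0; inZp 1]]%N.

Lemma starter_development : starter_check ->
  exists G : partial_linear_space,
    [/\ pentagonal k r G,
        connected_graph (@deficiency G)
      & girth_at_least 5 (@deficiency G)].
Proof.
case/and5P=> k_gt1 r_gt0 oddN size_st.
case/and4P=> /allP blocksP check0 check1 /allP ball0.
set N := (k + r * k.-1)%N in oddN *.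
have modd m : odd (m %% N.+1) = odd m by rewrite odd_mod //= oddN.
have oddB (x y : V) : odd (x - y)%R = odd x (+) odd y.
  have -> : odd (x - y)%R = odd ((x + (N.+1 - y) %% N.+1) %% N.+1) by [].
  by rewrite modd oddD modd oddB 1?ltnW //= oddN.
have oddD (x y : V) : odd (x + y)%R = odd x (+) odd y.
  have -> : odd (x + y)%R = odd ((x + y) %% N.+1) by [].
  by rewrite modd oddD.
have odd_rep (x : V) : odd (parity_rep x) = odd x by rewrite /= modd; case: (odd x).
have rep_odd (x y : V) : odd x = odd y -> parity_rep x = parity_rep y.
  by rewrite /parity_rep => ->.
have rep_check (x : V) : local_check (parity_rep x).
  by rewrite /parity_rep; case: (odd x).
have evens_zmod : zmod_closed evens.
  split=> [|x y]; first by rewrite inE.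
  by rewrite !inE oddB => /negPf-> /negPf->.
have repP x : x - parity_rep x \in evens by rewrite inE oddB odd_rep addbb.
have repD x h : h \in evens -> parity_rep (x + h) = parity_rep x.
  by rewrite inE => /negPf odd_h; apply: rep_odd; rewrite oddD odd_h addbF.
have oppP x : opposite (parity_rep x) \in starter_blocks.
  by rewrite mem_nth // size_map; case: (odd _) => //; apply: ltnW.
have cardV : #|V| = (k.+1 + r * k.-1)%N by rewrite card_ord.
have size_p x : size (pencil evens ord_leq starter_blocks (parity_rep x)) = r.
  by have /and3P[/eqP] := rep_check x.
have uniq_p x : let p := parity_rep x in
    uniq (p :: opposite p ++ flatten
      [seq rem p L | L <- pencil evens ord_leq starter_blocks p]).
  by have /and3P[] := rep_check x.
have uniq_b x : uniq (ball2 parity_rep opposite (parity_rep x)).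
  by have /and3P[] := rep_check x.
have evens_cyclic h : h \in evens -> exists n, h = inZp 2 *+ n.
  rewrite inE => even_h; exists h./2; apply: val_inj.
  by rewrite Zp_mulrn /= modnMml mul2n even_halfK // modn_small.
exists (development evens_zmod repP blocksP uniq_p); split.
- exact: dev_pentagonal k_gt1 r_gt0 cardV _ oppP size_p _.
- apply: (dev_connected _ _ r_gt0 cardV _ oppP size_p _ repD evens_cyclic _ _ ball0).
    by rewrite inE /= modd.
  by move=> x; rewrite /parity_rep; case: (odd x); rewrite !inE eqxx ?orbT.
- by move=> c; apply: (dev_girth r_gt0 cardV oppP size_p repD uniq_b).
Qed.

End StepTwo.

(** * The starter blocks *)

(** For each [r] the pair of [r] with its starter blocks modulo [4 r + 6].  When
    [r = 1 %[mod 5]], the cosets of the subgroup of order 5 that contain [0] and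
    [1] are among them:
    the translates of one coset partition the points of its parity, so they put
    a single line through each, which is the remainder of [r] modulo 5.  Any
    other starter block has as many distinct translates as there are points of
    one parity. *)
Definition families : seq (nat * seq (seq nat)) :=
  [::
    (20, [:: [:: 1; 39; 42; 44; 51]; [:: 0; 27; 36; 48; 61];
        [:: 0; 3; 32; 40; 66]; [:: 0; 4; 10; 21; 28]; [:: 0; 5; 16; 71; 72];
        [:: 0; 15; 29; 33; 73]; [:: 0; 22; 53; 63; 69];
        [:: 0; 35; 37; 59; 67]]);
    (21, [:: [:: 1; 12; 51; 78; 89]; [:: 0; 2; 9; 40; 83];
        [:: 0; 3; 15; 29; 73]; [:: 0; 4; 35; 57; 60]; [:: 0; 5; 26; 46; 74];
        [:: 0; 6; 25; 67; 82]; [:: 0; 10; 27; 32; 55];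
        [:: 0; 18; 36; 54; 72]; [:: 0; 37; 41; 47; 71];
        [:: 1; 19; 37; 55; 73]]);
    (25, [:: [:: 1; 25; 52; 54; 97]; [:: 0; 10; 51; 57; 82];
        [:: 0; 3; 38; 60; 80]; [:: 0; 4; 16; 39; 105]; [:: 0; 5; 13; 27; 50];
        [:: 0; 6; 15; 17; 93]; [:: 0; 7; 18; 48; 92]; [:: 0; 8; 36; 67; 99];
        [:: 0; 19; 37; 40; 73]; [:: 1; 5; 49; 69; 95]]);
    (26, [:: [:: 1; 54; 56; 75; 91]; [:: 0; 20; 33; 36; 79];
        [:: 0; 3; 51; 64; 109]; [:: 0; 4; 9; 89; 104]; [:: 0; 7; 31; 41; 78];
        [:: 0; 8; 25; 34; 48]; [:: 0; 11; 18; 60; 98];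
        [:: 0; 22; 44; 66; 88]; [:: 0; 24; 53; 71; 82];
        [:: 0; 27; 69; 77; 83]; [:: 0; 65; 67; 93; 105];
        [:: 1; 23; 45; 67; 89]]);
    (30, [:: [:: 1; 43; 45; 51; 75]; [:: 0; 52; 76; 82; 84];
        [:: 0; 3; 7; 18; 110]; [:: 0; 4; 37; 40; 101]; [:: 0; 5; 17; 65; 85];
        [:: 0; 9; 25; 62; 72]; [:: 0; 11; 28; 99; 106];
        [:: 0; 12; 68; 103; 125]; [:: 0; 13; 22; 69; 105];
        [:: 0; 14; 29; 55; 60]; [:: 0; 21; 39; 49; 88];
        [:: 0; 26; 53; 93; 107]]);
    (31, [:: [:: 1; 64; 66; 81; 97]; [:: 0; 5; 34; 50; 127];
        [:: 0; 3; 70; 89; 94]; [:: 0; 4; 44; 113; 123];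
        [:: 0; 6; 59; 61; 118]; [:: 0; 7; 99; 100; 108];
        [:: 0; 9; 32; 75; 88]; [:: 0; 10; 23; 38; 58];
        [:: 0; 11; 35; 54; 116]; [:: 0; 21; 46; 91; 103];
        [:: 0; 26; 52; 78; 104]; [:: 0; 27; 41; 47; 83];
        [:: 1; 19; 41; 73; 103]; [:: 1; 27; 53; 79; 105]]);
    (35, [:: [:: 1; 49; 55; 57; 143]; [:: 0; 4; 90; 92; 98];
        [:: 0; 3; 33; 62; 134]; [:: 0; 5; 100; 110; 129];
        [:: 0; 7; 20; 70; 139]; [:: 0; 9; 27; 32; 112];
        [:: 0; 11; 22; 111; 121]; [:: 0; 13; 44; 82; 122];
        [:: 0; 14; 35; 85; 105]; [:: 0; 16; 47; 75; 120];
        [:: 0; 17; 18; 97; 131]; [:: 0; 23; 95; 107; 116];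
        [:: 0; 25; 63; 103; 127]; [:: 0; 28; 67; 93; 109]]);
    (36, [:: [:: 1; 59; 107; 109; 125]; [:: 0; 26; 42; 44; 92];
        [:: 0; 3; 4; 101; 141]; [:: 0; 5; 10; 51; 73];
        [:: 0; 6; 83; 118; 139]; [:: 0; 7; 76; 87; 121];
        [:: 0; 8; 88; 122; 131]; [:: 0; 12; 27; 31; 110];
        [:: 0; 13; 23; 46; 68]; [:: 0; 14; 61; 69; 89];
        [:: 0; 17; 79; 93; 130]; [:: 0; 24; 49; 96; 135];
        [:: 0; 29; 35; 94; 147]; [:: 0; 30; 60; 90; 120];
        [:: 0; 33; 57; 64; 129]; [:: 1; 31; 61; 91; 121]]);
    (40, [:: [:: 1; 63; 73; 75; 119]; [:: 0; 48; 92; 94; 104];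
        [:: 0; 3; 117; 150; 155]; [:: 0; 4; 69; 149; 157];
        [:: 0; 6; 97; 102; 132]; [:: 0; 7; 26; 43; 141];
        [:: 0; 8; 45; 49; 86]; [:: 0; 9; 25; 114; 152];
        [:: 0; 11; 98; 130; 151]; [:: 0; 13; 66; 84; 108];
        [:: 0; 15; 81; 99; 123]; [:: 0; 20; 51; 121; 127];
        [:: 0; 22; 50; 105; 159]; [:: 0; 27; 67; 87; 90];
        [:: 0; 29; 59; 60; 93]; [:: 0; 35; 57; 85; 112]]);
    (41, [:: [:: 1; 43; 93; 147; 169]; [:: 0; 2; 24; 78; 128];
        [:: 0; 3; 30; 110; 141]; [:: 0; 4; 45; 71; 109];
        [:: 0; 5; 20; 72; 142]; [:: 0; 6; 121; 131; 162];
        [:: 0; 7; 91; 154; 165]; [:: 0; 9; 12; 25; 96];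
        [:: 0; 10; 61; 69; 75]; [:: 0; 15; 35; 87; 157];
        [:: 0; 17; 47; 127; 138]; [:: 0; 18; 57; 113; 130];
        [:: 0; 19; 37; 56; 77]; [:: 0; 26; 64; 145; 149];
        [:: 0; 27; 73; 108; 161]; [:: 0; 29; 36; 82; 137];
        [:: 0; 34; 68; 102; 136]; [:: 1; 35; 69; 103; 137]]);
    (45, [:: [:: 1; 13; 137; 139; 181]; [:: 0; 6; 48; 50; 174];
        [:: 0; 3; 29; 97; 116]; [:: 0; 4; 88; 112; 177];
        [:: 0; 5; 33; 40; 87]; [:: 0; 7; 23; 79; 152];
        [:: 0; 8; 46; 141; 161]; [:: 0; 9; 17; 20; 55];
        [:: 0; 10; 49; 110; 129]; [:: 0; 11; 32; 75; 90];
        [:: 0; 14; 36; 66; 81]; [:: 0; 16; 72; 109; 143];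
        [:: 0; 21; 31; 106; 131]; [:: 0; 26; 77; 94; 147];
        [:: 0; 27; 64; 123; 155]; [:: 0; 28; 82; 145; 185];
        [:: 0; 61; 85; 159; 163]; [:: 0; 69; 83; 105; 135]])
  ].

Definition starters (r : nat) : seq (seq nat) :=
  head [::] [seq f.2 | f <- families & f.1 == r].

Lemma starters_check :
  all (fun r => starter_check 5 r (starters r)) (unzip1 families).
Proof. by vm_compute. Qed.

Theorem lemma5p2 : forall r : nat,
  r \in [:: 20; 21; 25; 26; 30; 31; 35; 36; 40; 41; 45] ->
  exists G : partial_linear_space,
    [/\ pentagonal 5 r G,
        connected_graph (@deficiency G)
      & girth_at_least 5 (@deficiency G)].
Proof. by move=> r /(allP starters_check)/starter_development. Qed.
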